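(* For any $\varphi,\psi\in L^1(\mathcal N)$ and any $\tau\in\mathbb R^r$, we have $$\widetilde{\varphi}_\tau *_\tau \widetilde{\psi}_\tau=(\widetilde{\varphi*\psi})_\tau .$$
   Context: Let $n,r\ge 1$ and let $B:\mathbb R^{2n}\times\mathbb R^{2n}\to\mathbb R^r$ be a skew-symmetric bilinear map, $B=(B^1,\dots,B^r)$, $B^\beta(x,y)=\sum_{k,l=1}^{2n}B^\beta_{kl}x_ky_l$ with each $(B^\beta_{kl})$ real skew-symmetric. $\mathcal N$ is the group $\mathbb R^{2n}\times\mathbb R^r$ with multiplication $(x,t)\cdot(y,s)=(x+y,\,t+s+2B(x,y))$; Lebesgue measure is a Haar measure, and $L^p(\mathcal N)=L^p(\mathbb R^{2n+r})$. For $\tau\in\mathbb R^r$ put $B^\tau(x,y)=\sum_{\beta=1}^r\tau_\beta B^\beta(x,y)$. Convolution on $\mathcal N$: $\varphi*\psi(y,s)=\int_{\mathcal N}\varphi\big((y,s)(x,t)^{-1}\big)\psi(x,t)\,dx\,dt$. Partial Fourier transformation: $\widetilde{\varphi}_\tau(y)=\int_{\mathbb R^r}e^{-i\tau\cdot s}\varphi(y,s)\,ds$. Twisted convolution of $f,g\in L^1(\mathbb R^{2n})$: $f*_\tau g(y)=\int_{\mathbb R^{2n}}e^{-2iB^\tau(y,x)}f(y-x)g(x)\,dx$. Equality is as elements of $L^1(\mathbb R^{2n})$. *)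

(* Defs.v *)
From HB Require Import structures.
From mathcomp Require Import all_boot all_order all_algebra.
From mathcomp Require Import complex.
From mathcomp Require Import all_classical all_reals all_analysis.

Set Implicit Arguments.
Unset Strict Implicit.
Unset Printing Implicit Defensive.
Import Order.TTheory GRing.Theory Num.Theory.
Import numFieldNormedType.Exports.

Local Open Scope classical_set_scope.
Local Open Scope ring_scope.
Local Open Scope complex_scope.

(* R^n is [ 'rV[R]_n ], with the sigma-algebra generated by the coordinates, that
   is, the Borel sigma-algebra; this is the structure the library puts on
   [n.-tuple T]. *)
Definition rV_display : measure_display -> measure_display.
Proof. exact. Qed.

Section measurable_rV.
Context {d} {T : measurableType d}.
Variable n : nat.

Definition rV_coord : 'I_n -> 'rV[T]_n -> T := fun i x => x ord0 i.

Let rV_set0 : g_sigma_preimage rV_coord set0.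
Proof. exact: sigma_algebra0. Qed.

Let rV_setC A : g_sigma_preimage rV_coord A -> g_sigma_preimage rV_coord (~` A).
Proof. exact: sigma_algebraC. Qed.

Let rV_bigcup (F : _^nat) : (forall i, g_sigma_preimage rV_coord (F i)) ->
  g_sigma_preimage rV_coord (\bigcup_i (F i)).
Proof. exact: sigma_algebra_bigcup. Qed.

HB.instance Definition _ := @isMeasurable.Build (rV_display d)
  'rV[T]_n (g_sigma_preimage rV_coord) rV_set0 rV_setC rV_bigcup.

End measurable_rV.

Lemma measurable_rV_coord d (T : measurableType d) n (i : 'I_n) :
  measurable_fun [set: 'rV[T]_n] (@rV_coord _ T n i).
Proof.
move=> _ Y mY; rewrite setTI; apply: sub_sigma_algebra => /=.
rewrite -bigcup_seq/=; exists i => /=; first by rewrite mem_index_enum.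
by exists Y => //; rewrite setTI.
Qed.

Lemma measurable_fun_rVP d1 d2 (T1 : measurableType d1) (T2 : measurableType d2)
    n (f : T1 -> 'rV[T2]_n) :
  measurable_fun setT f <->
  forall i, measurable_fun setT (fun x => f x ord0 i).
Proof.
split=> [mf i|mf].
  exact: (measurableT_comp (@measurable_rV_coord _ T2 n i) mf).
move=> _ A mA; rewrite setTI.
suff : g_sigma_preimage (fun i => @rV_coord _ T2 n i \o f) `<=` measurable.
  by rewrite g_sigma_preimage_comp; apply; exists A => //; rewrite setTI.
apply: smallest_sub; first exact: sigma_algebra_measurable.
case: n => [|n] in f A mA mf *; first by rewrite big_ord0.
rewrite -bigcup_mkord_ord; apply: bigcup_sub => i Ii.
by move=> B [C mC <-]; exact: mf.
Qed.

Definition rV_cons (T : Type) n (p : T * 'rV[T]_n) : 'rV[T]_n.+1 :=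
  \row_(i < n.+1) oapp (fun j => p.2 ord0 j) p.1 (unlift ord0 i).

Definition rV_uncons (T : Type) n (v : 'rV[T]_n.+1) : T * 'rV[T]_n :=
  (v ord0 ord0, \row_j v ord0 (lift ord0 j)).

Lemma rV_consK T n : cancel (@rV_cons T n) (@rV_uncons T n).
Proof.
case=> x v; rewrite /rV_uncons /rV_cons !mxE/= unlift_none/=; congr pair.
by apply/rowP => j; rewrite !mxE liftK.
Qed.

Lemma rV_unconsK T n : cancel (@rV_uncons T n) (@rV_cons T n).
Proof.
move=> v; apply/rowP => i; rewrite !mxE.
by case: unliftP => [j ->|->] /=; rewrite ?mxE.
Qed.

(* [lebesgue_measure] lives on [measurableTypeR R], an alias of [R] with the same
   (Borel) measurable sets but another display. *)
Lemma measurable_rV_cons (R : realType) n :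
  measurable_fun setT
    (@rV_cons R n : measurableTypeR R * 'rV[R]_n -> 'rV[R]_n.+1).
Proof.
apply/measurable_fun_rVP => i; rewrite /rV_cons.
under eq_fun do rewrite mxE.
case: unliftP => [j _|_] /=.
  exact: (measurableT_comp (@measurable_rV_coord _ R n j) measurable_snd).
exact: (@measurable_fst _ _ (measurableTypeR R) 'rV[R]_n).
Qed.

Lemma measurable_rV_uncons (R : realType) n :
  measurable_fun setT
    (@rV_uncons R n : 'rV[R]_n.+1 -> measurableTypeR R * 'rV[R]_n).
Proof.
apply: measurable_fun_pair; first exact: measurable_rV_coord.
apply/measurable_fun_rVP => i.
under eq_fun do rewrite mxE.
exact: measurable_rV_coord.
Qed.

(* The library's canonical sigma-finite structure on a product only covers
   subprobabilities. *)
Lemma product_measure1_sigma_finite d1 d2 (T1 : measurableType d1)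
    (T2 : measurableType d2) (R : realType)
    (m1 : {sigma_finite_measure set T1 -> \bar R})
    (m2 : {sigma_finite_measure set T2 -> \bar R}) :
  sigma_finite setT (m1 \x m2)%E.
Proof.
have /sigma_finiteP[F [TF ndF Foo]] := sigma_finiteT m1.
have /sigma_finiteP[G [TG ndG Goo]] := sigma_finiteT m2.
exists (fun n => F n `*` G n).
  rewrite -setXTT TF TG predeqE => -[x y]; split.
    move=> [/= [n _ Fnx] [k _ Gky]]; exists (maxn n k) => //; split.
    - by move: x Fnx; exact/subsetPset/ndF/leq_maxl.
    - by move: y Gky; exact/subsetPset/ndG/leq_maxr.
  by move=> [n _ []/= ? ?]; split; exists n.
move=> k; have [? ?] := Foo k; have [? ?] := Goo k.
split; first exact: measurableX.
by rewrite product_measure1E// lte_mul_pinfty// ge0_fin_numE.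
Qed.

Section lebesgue_rV_succ.
Local Open Scope ereal_scope.
Context {R : realType} (n : nat).
Variable mu : {sigma_finite_measure set 'rV[R]_n -> \bar R}.

Let cons : measurableTypeR R * 'rV[R]_n -> 'rV[R]_n.+1 := @rV_cons R n.

Definition lebesgue_rV_succ : set 'rV[R]_n.+1 -> \bar R :=
  pushforward (lebesgue_measure \x mu) cons.

Let ms0 : lebesgue_rV_succ set0 = 0.
Proof. by rewrite /lebesgue_rV_succ /pushforward preimage_set0 measure0. Qed.

Let ms_ge0 A : 0 <= lebesgue_rV_succ A.
Proof. by rewrite /lebesgue_rV_succ /pushforward measure_ge0. Qed.

Let mcons A : measurable A -> measurable (cons @^-1` A).
Proof. by move=> mA; rewrite -[X in measurable X]setTI; exact: measurable_rV_cons. Qed.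

Let ms_sigma_additive : semi_sigma_additive lebesgue_rV_succ.
Proof.
move=> F mF tF mUF; rewrite /lebesgue_rV_succ /pushforward preimage_bigcup.
apply: measure_semi_sigma_additive.
- by move=> k; exact: mcons.
- apply/trivIsetP => /= i j _ _ ij; rewrite -preimage_setI.
  by move/trivIsetP : tF => /(_ _ _ _ _ ij) ->//; rewrite preimage_set0.
- by rewrite -preimage_bigcup; exact: mcons.
Qed.

HB.instance Definition _ := isMeasure.Build _ _ _ lebesgue_rV_succ
  ms0 ms_ge0 ms_sigma_additive.

Let ms_sigma_finite : sigma_finite setT lebesgue_rV_succ.
Proof.
have [F TF Foo] := product_measure1_sigma_finite lebesgue_measure mu.
pose uncons : 'rV[R]_n.+1 -> measurableTypeR R * 'rV[R]_n := @rV_uncons R n.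
exists (fun k => uncons @^-1` F k).
  by rewrite -preimage_bigcup -TF preimage_setT.
move=> k; have [mFk Fkoo] := Foo k; split.
  by rewrite -[X in measurable X]setTI; exact: measurable_rV_uncons.
rewrite /lebesgue_rV_succ /pushforward -comp_preimage.
rewrite (_ : uncons \o cons = id)//.
by apply/funext => p; rewrite /uncons /cons /comp rV_consK.
Qed.

HB.instance Definition _ := Measure_isSigmaFinite.Build _ _ _ lebesgue_rV_succ
  ms_sigma_finite.

End lebesgue_rV_succ.

(* R^0 is a point of mass 1 and R^(n+1) = R x R^n. *)
Fixpoint lebesgue_rV {R : realType} (n : nat) :
    {sigma_finite_measure set 'rV[R]_n -> \bar R} :=
  if n is n'.+1 then lebesgue_rV_succ (lebesgue_rV n') else \d_(0 : 'rV[R]_0).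

Lemma lebesgue_rV_box (R : realType) n (A : 'I_n -> set (measurableTypeR R)) :
  (forall i, measurable (A i)) ->
  lebesgue_rV n [set v : 'rV[R]_n | forall i, A i (v ord0 i)] =
  (\prod_(i < n) lebesgue_measure (A i))%E.
Proof.
elim: n A => [|n IHn] A mA.
  by rewrite big_ord0 /= diracE mem_set// => -[].
pose A' i := A (lift ord0 i).
pose box : set 'rV[R]_n := [set v | forall i, A' i (v ord0 i)].
have mbox : measurable box.
  rewrite (_ : box = \bigcap_(i in [set: 'I_n]) (@rV_coord _ R n i @^-1` A' i)).
    apply: fin_bigcap_measurable => // i _; rewrite -[X in measurable X]setTI.
    by apply: (@measurable_rV_coord _ R n i) => //; exact: mA.
  by apply/seteqP; split => v Av i; [move=> _; exact: Av | exact: Av].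
rewrite big_ord_recl -(IHn A'); last by move=> i; exact: mA.
rewrite -/box.
rewrite -(product_measure1E lebesgue_measure (lebesgue_rV n))//.
rewrite [LHS]/= /lebesgue_rV_succ /pushforward; congr (product_measure1 _ _ _).
apply/seteqP; split => -[x v] /=.
  move=> Av; split => [|i]; first by have := Av ord0; rewrite mxE unlift_none.
  by have := Av (lift ord0 i); rewrite mxE liftK.
by move=> [Ax Av] i; rewrite mxE; case: unliftP => [j ->|->] //=; exact: Av.
Qed.

Section complex_L1.
Context d (T : measurableType d) (R : realType).
Variable mu : {measure set T -> \bar R}.

(* Membership in L^1(mu) for a function; an element of L^1(mu) is such a function
   up to equality mu-almost everywhere. *)
Definition L1 (f : T -> R[i]) : Prop :=
  [/\ measurable_fun setT (fun x => complex.Re (f x)),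
      measurable_fun setT (fun x => complex.Im (f x)) &
      (\int[mu]_x (ComplexField.Normc.normc (f x))%:E < +oo)%E].

Definition eqL1 (f g : T -> R[i]) : Prop :=
  [/\ L1 f, L1 g & f = g %[ae mu]].

(* As with [Rintegral], the value is only meaningful for integrable [f]. *)
Definition Cintegral (f : T -> R[i]) : R[i] :=
  (\int[mu]_x complex.Re (f x)) +i* (\int[mu]_x complex.Im (f x)).

End complex_L1.

Definition expi {R : realType} (theta : R) : R[i] := cos theta +i* sin theta.

Section nilpotent_group.
Context {R : realType} {m r : nat}.
Variable B : 'rV[R]_m -> 'rV[R]_m -> 'rV[R]_r.
Local Notation N := ('rV[R]_m * 'rV[R]_r)%type.

Definition nil_mul (p q : N) : N := (p.1 + q.1, p.2 + q.2 + 2 *: B p.1 q.1).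

(* The inverse for [nil_mul] because B x x = 0. *)
Definition nil_inv (p : N) : N := (- p.1, - p.2).

Definition nil_lebesgue : set N -> \bar R := (lebesgue_rV m \x lebesgue_rV r)%E.

HB.instance Definition _ := Measure.copy nil_lebesgue
  (lebesgue_rV m \x lebesgue_rV r)%E.
HB.instance Definition _ := Measure_isSigmaFinite.Build _ _ _ nil_lebesgue
  (product_measure1_sigma_finite (lebesgue_rV m) (lebesgue_rV r)).

(* The convolution integrals converge almost everywhere only. *)
Definition nil_conv (phi psi : N -> R[i]) (p : N) : R[i] :=
  Cintegral nil_lebesgue (fun q => phi (nil_mul p (nil_inv q)) * psi q).

Definition dotr (tau s : 'rV[R]_r) : R := \sum_(b < r) tau ord0 b * s ord0 b.

(* The Fourier integral converges for almost every [y] only. *)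
Definition partial_fourier (tau : 'rV[R]_r) (phi : N -> R[i]) (y : 'rV[R]_m) :
    R[i] :=
  Cintegral (lebesgue_rV r) (fun s => expi (- dotr tau s) * phi (y, s)).

Definition Btau (tau : 'rV[R]_r) (x y : 'rV[R]_m) : R := dotr tau (B x y).

Definition twisted_conv (tau : 'rV[R]_r) (f g : 'rV[R]_m -> R[i])
    (y : 'rV[R]_m) : R[i] :=
  Cintegral (lebesgue_rV m)
    (fun x => expi (- (2 * Btau tau y x)) * f (y - x) * g x).

End nilpotent_group.

Section nilpotent_group_laws.
Context {R : realType} {m r : nat}.
Variable B : {bilinear 'rV[R]_m -> 'rV[R]_m -> 'rV[R]_r}.
Hypothesis skewB : forall x y, B x y = - B y x.

Let B_diag x : B x x = 0.
Proof.
have /eqP := skewB x x; rewrite -addr_eq0 -mulr2n -scaler_nat scaler_eq0.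
by rewrite pnatr_eq0 /= => /eqP.
Qed.

Lemma nil_mulA : associative (nil_mul B).
Proof.
move=> [x t] [y s] [z u]; rewrite /nil_mul /= linearDr linearDl !scalerDr.
congr pair; first by rewrite addrA.
rewrite -!addrA; congr (_ + (_ + _)).
by rewrite [RHS]addrCA; congr (_ + _); rewrite addrC -addrA.
Qed.

Lemma nil_mulV p : nil_mul B p (nil_inv p) = 0.
Proof.
by case: p => x t; rewrite /nil_mul /= linearNr B_diag oppr0 scaler0 addr0 !subrr.
Qed.

Lemma nil_mulVl p : nil_mul B (nil_inv p) p = 0.
Proof.
by case: p => x t; rewrite /nil_mul /= linearNl B_diag oppr0 scaler0 addr0 !addNr.
Qed.

Lemma nil_mul1 p : nil_mul B p 0 = p.
Proof. by case: p => x t; rewrite /nil_mul /= linear0r scaler0 !addr0. Qed.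

Lemma nil_mul1l p : nil_mul B 0 p = p.
Proof. by case: p => x t; rewrite /nil_mul /= linear0l scaler0 addr0 !add0r. Qed.

End nilpotent_group_laws.

(* Main.v *)
From HB Require Import structures.
Require Import Defs.
From mathcomp Require Import all_boot all_order all_algebra.
From mathcomp Require Import complex.
From mathcomp Require Import all_classical all_reals all_analysis.
From mathcomp Require Import measurable_realfun ring.

Set Implicit Arguments.
Unset Strict Implicit.
Unset Printing Implicit Defensive.
Import Order.TTheory GRing.Theory Num.Theory.
Import numFieldNormedType.Exports.

Local Open Scope classical_set_scope.
Local Open Scope ring_scope.

(** The identity is Fubini's theorem together with one substitution. For fixed
    y, the right-hand side is the integral of
<<
      e^{-i tau.s} phi(y - x, s - t - 2 B(y, x)) psi(x, t)
>>
    over (x, t) first and then over s. Integrating over s first instead, and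
    substituting s + t + 2 B(y, x) for s, splits off the phases e^{-i tau.t},
    which turns psi into its partial Fourier transform once t is
    integrated, and e^{-2i B^tau(y, x)}, which is the twist; what remains is the
    partial Fourier transform of phi at y - x.

    Fubini's theorem applies for almost every y. Right translations of the group
    preserve Lebesgue measure, because they are translations of the first factor
    followed, in each fibre, by a translation of the second factor
    ([measure_preserving_skew_product], [nil_right_translation]). Hence the
    convolution kernel phi(p q^-1) psi(q) is in L^1 of the product of the group
    with itself ([L1_translate_tensor]), and Tonelli's theorem makes its
    restriction to p in {y} x R^r integrable for almost every y
    ([L1_nil_sections]). For such a y the computation above is
    [partial_fourier_nil_conv].

    The integrability of the convolution and of its partial Fourier transform is
    a by-product of Fubini's theorem: the marginals of an L^1 function are in
    L^1 ([L1_Cintegral1]). Since an integral has a value even where it diverges,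
    measurability of such marginals has to be known everywhere and not only
    almost everywhere; it holds because the integrals of the positive and of the
    negative part always depend measurably on the parameter
    ([measurable_Rintegral1]). The twisted convolution is then in L^1 as a
    measurable function almost everywhere equal to one that is. *)

Local Notation normc := ComplexField.Normc.normc.

(** * Measure-preserving maps *)

Definition measure_preserving d (T : measurableType d) (R : realType)
    (mu : {measure set T -> \bar R}) (phi : T -> T) : Prop :=
  measurable_fun setT phi /\
  forall A, measurable A -> mu (phi @^-1` A) = mu A.

Section measure_preserving.
Local Open Scope ereal_scope.

(** For nonnegative functions this is integration against the image measure. The
    positive and negative parts are treated separately, so that divergent
    integrals are covered too. *)
Lemma integral_measure_preserving d (T : measurableType d) (R : realType)
    (mu : {measure set T -> \bar R}) (phi : T -> T) (f : T -> \bar R) :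
  measure_preserving mu phi -> measurable_fun setT f ->
  \int[mu]_x f (phi x) = \int[mu]_x f x.
Proof.
move=> [mphi muphi] mf.
have ge0_eq (g : T -> \bar R) : measurable_fun setT g -> (forall x, 0 <= g x) ->
    \int[mu]_x g (phi x) = \int[mu]_x g x.
  move=> mg g0; have := ge0_integral_pushforward mphi mu measurableT mg.
  rewrite preimage_setT => <-; last by move=> x _; exact: g0.
  by apply: eq_measure_integral => A mA _; exact: muphi.
rewrite [LHS]integralE [RHS]integralE; congr (_ - _).
- under eq_integral do rewrite (funepos_comp f phi) /=.
  by apply: ge0_eq => //; exact: measurable_funepos.
- under eq_integral do rewrite (funeneg_comp f phi) /=.
  by apply: ge0_eq => //; exact: measurable_funeneg.
Qed.

(** By Cavalieri's principle: over the point x, the preimage of A has the same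
    measure as the section of A over S x, and the measures of these sections
    are then integrated along S. *)
Lemma measure_preserving_skew_product d1 d2 (T1 : measurableType d1)
    (T2 : measurableType d2) (R : realType)
    (m1 : {sigma_finite_measure set T1 -> \bar R})
    (m2 : {sigma_finite_measure set T2 -> \bar R})
    (S : T1 -> T1) (U : T1 -> T2 -> T2) :
  measure_preserving m1 S -> (forall x, measure_preserving m2 (U x)) ->
  measurable_fun setT (fun p : T1 * T2 => (S p.1, U p.1 p.2)) ->
  measure_preserving (m1 \x m2) (fun p : T1 * T2 => (S p.1, U p.1 p.2)).
Proof.
move=> pS pU mSU; split=> // A mA.
rewrite /= /product_measure1.
transitivity (\int[m1]_x (m2 \o xsection A) (S x)).
  apply: eq_integral => x _ /=.
  rewrite -[RHS](proj2 (pU x)); last exact: measurable_xsection.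
  apply: congr1; apply/seteqP; split => y; rewrite /xsection/= !inE//.
apply: (@integral_measure_preserving _ _ _ m1 S (m2 \o xsection A)) => //.
exact: measurable_fun_xsection.
Qed.

End measure_preserving.

(** * Translation invariance of Lebesgue measure on row vectors *)

Section measurable_rV_ops.
Context d (T : measurableType d) (R : realType) (n : nat).
Implicit Types f g : T -> 'rV[R]_n.

Lemma measurable_rVD f g : measurable_fun setT f -> measurable_fun setT g ->
  measurable_fun setT (fun x => f x + g x).
Proof.
move=> /measurable_fun_rVP mf /measurable_fun_rVP mg; apply/measurable_fun_rVP.
by move=> i; under eq_fun do rewrite mxE; exact: measurable_funD.
Qed.

Lemma measurable_rVZ (c : R) f : measurable_fun setT f ->
  measurable_fun setT (fun x => c *: f x).
Proof.
move=> /measurable_fun_rVP mf; apply/measurable_fun_rVP.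
by move=> i; under eq_fun do rewrite mxE; exact: measurable_funM.
Qed.

Lemma measurable_rVN f : measurable_fun setT f ->
  measurable_fun setT (fun x => - f x).
Proof.
by under [X in _ -> _ X]eq_fun do rewrite -scaleN1r; exact: measurable_rVZ.
Qed.

Lemma measurable_dotr (tau : 'rV[R]_n) f : measurable_fun setT f ->
  measurable_fun setT (fun x => dotr tau (f x)).
Proof.
move=> /measurable_fun_rVP mf; rewrite /dotr.
by apply: measurable_sum => i; apply: measurable_funM.
Qed.

Lemma measurable_bilinear m r (B : {bilinear 'rV[R]_m -> 'rV[R]_n -> 'rV[R]_r})
    (h : T -> 'rV[R]_m) f :
  measurable_fun setT h -> measurable_fun setT f ->
  measurable_fun setT (fun x => B (h x) (f x)).
Proof.
move=> /measurable_fun_rVP mh /measurable_fun_rVP mf; apply/measurable_fun_rVP.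
move=> k.
have E x : B (h x) (f x) ord0 k = \sum_(i < m) \sum_(j < n)
    h x ord0 i * (f x ord0 j * B (delta_mx 0 i) (delta_mx 0 j) ord0 k).
  rewrite [h x in LHS]row_sum_delta [f x in LHS]row_sum_delta.
  rewrite linear_sumlz summxE; apply: eq_bigr => i _.
  rewrite linear_sumr summxE; apply: eq_bigr => j _.
  by rewrite linearZl_LR linearZr_LR !mxE.
under eq_fun do rewrite E.
apply: measurable_sum => i; apply: measurable_sum => j.
by apply: measurable_funM => //; exact: measurable_funM.
Qed.

End measurable_rV_ops.

Section translations.
Context {R : realType}.

(** It is enough to compare lengths of half-open intervals, because these
    determine Lebesgue measure. *)
Lemma lebesgue_measure_translation (a : R) :
  measure_preserving (@lebesgue_measure R) (fun x => x + a).
Proof.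
pose tr : measurableTypeR R -> measurableTypeR R := fun x => x + a.
have mtr : measurable_fun setT tr by exact: measurable_funD.
pose mfun_tr : {mfun _ >-> _} :=
  HB.pack tr (isMeasurableFun.Build _ _ _ _ _ mtr).
split=> // A mA; rewrite -[LHS]/(pushforward lebesgue_measure mfun_tr A).
apply/esym/lebesgue_measure_unique => //= _ [[b c] _ <-].
rewrite /pushforward (_ : _ @^-1` _ = `]b - a, c - a]%classic); last first.
  by apply/seteqP; split => x; rewrite /= !in_itv/= ltrBlDr lerBrDr.
rewrite /= !lebesgue_measure_itv/= !lte_fin ltrD2r.
by case: ifPn => // _; rewrite -!EFinB opprB addrA subrK.
Qed.

(** By induction on the dimension: identifying R^(n+1) with R x R^n turns a
    translation into a product of translations. *)
Lemma lebesgue_rV_translation n (a : 'rV[R]_n) :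
  measure_preserving (lebesgue_rV n) (fun v => v + a).
Proof.
elim: n a => [|n IHn] a; split; try exact: measurable_rVD.
  by move=> A _; rewrite (_ : _ @^-1` _ = A)//; apply/seteqP; split => v;
    rewrite /= (_ : v + a = v)//; apply/rowP => -[].
move=> A mA; rewrite /= /lebesgue_rV_succ /pushforward.
pose a' : 'rV[R]_n := \row_j a ord0 (lift ord0 j).
have mcons : measurable
    ((@rV_cons R n : measurableTypeR R * 'rV[R]_n -> _) @^-1` A).
  by rewrite -[X in measurable X]setTI; exact: measurable_rV_cons.
have [tr1 tr2] := (lebesgue_measure_translation (a ord0 ord0), IHn a').
have [_ /(_ _ mcons) <-] := measure_preserving_skew_product tr1
  (fun=> tr2) (measurable_fun_pair (measurableT_comp tr1.1 measurable_fst)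
                 (measurableT_comp tr2.1 measurable_snd)).
have rV_consD x v : rV_cons (x + a ord0 ord0, v + a') = rV_cons (x, v) + a.
  by apply/rowP => i; rewrite !mxE; case: unliftP => [j|] -> /=; rewrite ?mxE.
congr (product_measure1 _ _ _).
by apply/seteqP; split => -[x v]; rewrite /= rV_consD.
Qed.

End translations.

(** * Integration of complex-valued functions *)

Section normc.
Context {R : realType}.
Implicit Types z : R[i].

Lemma normc_ge0 z : 0 <= normc z.
Proof. by case: z => a b; rewrite sqrtr_ge0. Qed.

Lemma norm_Re_le z : `|complex.Re z| <= normc z.
Proof. by case: z => a b /=; rewrite -sqrtr_sqr ler_wsqrtr// lerDl sqr_ge0. Qed.

Lemma norm_Im_le z : `|complex.Im z| <= normc z.
Proof. by case: z => a b /=; rewrite -sqrtr_sqr ler_wsqrtr// lerDr sqr_ge0. Qed.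

Lemma normc_le z : normc z <= `|complex.Re z| + `|complex.Im z|.
Proof.
case: z => a b /=; rewrite -[leRHS]ger0_norm ?addr_ge0// -sqrtr_sqr.
rewrite ler_wsqrtr// sqrrD !real_normK ?num_real//.
by rewrite lerD2r lerDl mulrn_wge0 ?mulr_ge0.
Qed.

Lemma normc_expi (theta : R) : normc (expi theta) = 1.
Proof. by rewrite /expi/= cos2Dsin2 sqrtr1. Qed.

Lemma expiD (a b : R) : expi (a + b) = expi a * expi b.
Proof. by rewrite /expi cosD sinD; congr (_ +i* _)%C; rewrite addrC. Qed.

End normc.

(** Borel measurability as a map into the plane, checked on coordinates. *)
Definition cmeasurable d (T : measurableType d) (R : realType) (f : T -> R[i]) :
    Prop :=
  measurable_fun setT (fun x => complex.Re (f x)) /\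
  measurable_fun setT (fun x => complex.Im (f x)).

Section cmeasurable.
Context d (T : measurableType d) (R : realType).
Implicit Types f g : T -> R[i].

Lemma cmeasurable_comp d' (T' : measurableType d') (h : T' -> T) f :
  cmeasurable f -> measurable_fun setT h -> cmeasurable (fun x => f (h x)).
Proof.
move=> [fR fI] mh.
by split; [exact: (measurableT_comp fR)|exact: (measurableT_comp fI)].
Qed.

Lemma cmeasurable_cst (c : R[i]) : cmeasurable (fun _ : T => c).
Proof. by split. Qed.

Lemma cmeasurableM f g :
  cmeasurable f -> cmeasurable g -> cmeasurable (fun x => f x * g x).
Proof.
move=> [fR fI] [gR gI]; split.
  rewrite (_ : (fun x => _) = (fun x => complex.Re (f x) * complex.Re (g x) -
      complex.Im (f x) * complex.Im (g x))); last first.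
    by apply/funext => x; case: (f x); case: (g x).
  by apply: measurable_funB; exact: measurable_funM.
rewrite (_ : (fun x => _) = (fun x => complex.Re (f x) * complex.Im (g x) +
    complex.Im (f x) * complex.Re (g x))); last first.
  by apply/funext => x; case: (f x); case: (g x).
by apply: measurable_funD; exact: measurable_funM.
Qed.

Lemma cmeasurable_expi (theta : T -> R) :
  measurable_fun setT theta -> cmeasurable (fun x => expi (theta x)).
Proof.
move=> mt; split => /=.
  exact: (measurableT_comp (continuous_measurable_fun (@continuous_cos R))).
exact: (measurableT_comp (continuous_measurable_fun (@continuous_sin R))).
Qed.

Lemma measurable_normc f :
  cmeasurable f -> measurable_fun setT (fun x => normc (f x)).
Proof.
move=> [fR fI]; rewrite (_ : (fun x => _) = Num.sqrt \o
    (fun x => complex.Re (f x) ^+ 2 + complex.Im (f x) ^+ 2)); last first.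
  by apply/funext => x /=; case: (f x).
apply: measurableT_comp.
  exact: (continuous_measurable_fun (@sqrt_continuous R)).
by apply: measurable_funD; exact: measurable_funX.
Qed.

End cmeasurable.

Section L1.
Context d (T : measurableType d) (R : realType).
Variable mu : {measure set T -> \bar R}.
Implicit Types f g : T -> R[i].

Lemma L1_cmeasurable f : L1 mu f -> cmeasurable f.
Proof. by case. Qed.

(** The Euclidean norm is equivalent to the sum of the absolute values of the
    coordinates. *)
Lemma L1E f : L1 mu f <->
  mu.-integrable setT (fun x => (complex.Re (f x))%:E) /\
  mu.-integrable setT (fun x => (complex.Im (f x))%:E).
Proof.
split=> [[fR fI foo]|[fR fI]].
  have mn : measurable_fun setT (fun x => (normc (f x))%:E).
    by apply/measurable_EFinP/measurable_normc.
  by split; apply/integrableP; (split; first exact/measurable_EFinP);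
    apply: le_lt_trans foo; apply: ge0_le_integral => //;
    do ?[apply: measurableT_comp => //; exact/measurable_EFinP];
    move=> x _; rewrite lee_fin ?norm_Re_le ?norm_Im_le ?normc_ge0.
have /measurable_EFinP mR := measurable_int _ fR.
have /measurable_EFinP mI := measurable_int _ fI.
split=> //.
have /integrableP[_] := integrableD measurableT (integrable_abse fR)
  (integrable_abse fI).
apply: le_lt_trans; apply: ge0_le_integral => //.
- by move=> x _; rewrite lee_fin normc_ge0.
- exact/measurable_EFinP/measurable_normc.
- apply: measurableT_comp => //; apply: emeasurable_funD;
    by apply: measurableT_comp => //; exact/measurable_EFinP.
- move=> x _ /=; rewrite lee_fin ger0_norm ?addr_ge0//; exact: normc_le.
Qed.

Lemma L1Zl c f : L1 mu f -> L1 mu (fun x => c * f x).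
Proof.
move=> [fR fI foo].
have [mR mI] := cmeasurableM (cmeasurable_cst _ c) (conj fR fI).
split=> //; under eq_integral do rewrite ComplexField.Normc.normcM EFinM.
rewrite ge0_integralZl//.
- by rewrite lte_mul_pinfty// lee_fin normc_ge0.
- exact/measurable_EFinP/measurable_normc.
- by move=> x _; rewrite lee_fin normc_ge0.
- by rewrite lee_fin normc_ge0.
Qed.

Lemma L1_unimodular u f : cmeasurable u -> (forall x, normc (u x) = 1) ->
  L1 mu f -> L1 mu (fun x => u x * f x).
Proof.
move=> mu_ u1 [fR fI foo]; have [mR mI] := cmeasurableM mu_ (conj fR fI).
by split=> //; under eq_integral do rewrite ComplexField.Normc.normcM u1 mul1r.
Qed.

Let CintegralZl_L1 c f : L1 mu f ->
  Cintegral mu (fun x => c * f x) = c * Cintegral mu f.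
Proof.
move=> /L1E[iR iI]; rewrite /Cintegral; case: c => a b.
have ER x : complex.Re ((a +i* b)%C * f x) =
  a * complex.Re (f x) - b * complex.Im (f x) by case: (f x).
have EI x : complex.Im ((a +i* b)%C * f x) =
  a * complex.Im (f x) + b * complex.Re (f x) by case: (f x).
have iZ k (h : T -> R) : mu.-integrable setT (EFin \o h) ->
    mu.-integrable setT (EFin \o (fun x => k * h x)).
  by move=> ih; exact: (integrableZl measurableT k ih).
rewrite [RHS]/GRing.mul /=; congr (_ +i* _)%C.
  under eq_Rintegral do rewrite ER.
  by rewrite RintegralB ?RintegralZl//; exact: iZ.
under eq_Rintegral do rewrite EI.
by rewrite RintegralD ?RintegralZl//; exact: iZ.
Qed.

(** Integrability is asked of the product rather than of [f]: in an iterated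
    integral only the product is known to be integrable, and [c] may be 0. *)
Lemma CintegralZl c f : L1 mu (fun x => c * f x) ->
  Cintegral mu (fun x => c * f x) = c * Cintegral mu f.
Proof.
have [->|c0] := eqVneq c 0; last first.
  (* Dividing by [c] shows that [f] itself is integrable. *)
  move=> /(L1Zl c^-1); under eq_fun do rewrite mulrA mulVf// mul1r.
  exact: CintegralZl_L1.
move=> _; rewrite mul0r /Cintegral.
by congr (_ +i* _)%C; under eq_Rintegral do rewrite mul0r;
  rewrite Rintegral_cst// mul0r.
Qed.

Lemma eqL1_ae f g : L1 mu f -> cmeasurable g -> f = g %[ae mu] -> eqL1 mu f g.
Proof.
move=> fL1 [gR gI] fg; split=> //; split=> //.
case: (fL1) => fR fI; congr (_ < _)%E; apply: ge0_ae_eq_integral => //.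
- exact/measurable_EFinP/measurable_normc.
- exact/measurable_EFinP/measurable_normc.
- by move=> x _; rewrite lee_fin normc_ge0.
- by move=> x _; rewrite lee_fin normc_ge0.
- by apply: filterS fg => x /= /[apply] ->.
Qed.

Lemma ae_eq_Cintegral f g : cmeasurable f -> cmeasurable g -> f = g %[ae mu] ->
  Cintegral mu f = Cintegral mu g.
Proof.
move=> [fR fI] [gR gI] fg; congr (_ +i* _)%C; congr fine;
  (apply: ae_eq_integral => //;
   [exact/measurable_EFinP|exact/measurable_EFinP|
    by apply: filterS fg => x /= /[apply] ->]).
Qed.

Lemma Cintegral_measure_preserving (phi : T -> T) f :
  measure_preserving mu phi -> cmeasurable f ->
  Cintegral mu (fun x => f (phi x)) = Cintegral mu f.
Proof.
move=> pphi [fR fI]; congr (_ +i* _)%C; congr fine.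
  apply: (@integral_measure_preserving _ _ _ _ _
    (fun x => (complex.Re (f x))%:E)) => //.
  exact/measurable_EFinP.
apply: (@integral_measure_preserving _ _ _ _ _
    (fun x => (complex.Im (f x))%:E)) => //.
exact/measurable_EFinP.
Qed.

End L1.

(** * Fubini's theorem for complex-valued functions *)

Section Rfubini.
Context d1 d2 (T1 : measurableType d1) (T2 : measurableType d2) (R : realType).
Variables (m1 : {sigma_finite_measure set T1 -> \bar R})
  (m2 : {sigma_finite_measure set T2 -> \bar R}).

(** The inner integral of Fubini's theorem takes values in the extended reals,
    while the iterated real integral truncates infinite values to 0. The two
    agree almost everywhere. *)
Lemma fine_integrable d (T : measurableType d) (mu : {measure set T -> \bar R})
    (F : T -> \bar R) : mu.-integrable setT F ->
  mu.-integrable setT (fun x => (fine (F x))%:E) /\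
  (\int[mu]_x (fine (F x))%:E = \int[mu]_x F x)%E.
Proof.
move=> iF; have mF := measurable_int _ iF.
have mfF : measurable_fun setT (fun x => (fine (F x))%:E).
  by apply/measurable_EFinP; apply: measurableT_comp.
split.
  apply: (le_integrable measurableT mfF _ iF) => x _.
  by case: (F x) => [r| |] //=; rewrite ?normr0 ?leey.
apply: ae_eq_integral => //.
by apply: filterS (integrable_ae measurableT iF) => x /= /[apply] /fineK.
Qed.

Variable h : T1 * T2 -> R.

(** The integrals of the positive and of the negative part are measurable by
    Tonelli's theorem, and so is their difference, also where it is infinite or
    of the form oo - oo. *)
Lemma measurable_Rintegral1 : measurable_fun setT h ->
  measurable_fun setT (fun x => \int[m2]_y h (x, y)).
Proof.
move=> /measurable_EFinP mh; apply: measurableT_comp => //.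
rewrite (_ : (fun x => _) = (fun x => fubini_F m2 (EFin \o h)^\+ x -
    fubini_F m2 (EFin \o h)^\- x)%E); last first.
  apply/funext => x; rewrite integralE /fubini_F; by congr (_ - _)%E;
    apply: eq_integral => y _; rewrite ?funeposE ?funenegE.
apply: emeasurable_funB; apply: measurable_fun_fubini_tonelli_F => //.
  exact: measurable_funepos.
exact: measurable_funeneg.
Qed.

Hypothesis ih : (m1 \x m2)%E.-integrable setT (EFin \o h).

Lemma Rintegral1_integrable :
  m1.-integrable setT (fun x => (\int[m2]_y h (x, y))%:E).
Proof. exact: (fine_integrable (integrable_fubini_F ih)).1. Qed.

Let fubini_G_integrable : m2.-integrable setT (fubini_G m1 (EFin \o h)).
Proof.
have mh := measurable_int _ ih.
have mabs : measurable_fun setT (abse \o (EFin \o h)).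
  exact: measurableT_comp.
have mG := measurable_fubini_G ih.
apply/integrableP; split=> //.
apply: le_lt_trans ((integrable21ltyP _ _ mh).1 ih).
apply: ge0_le_integral => //.
- exact: measurableT_comp.
- by apply: (measurable_fun_fubini_tonelli_G _ mabs) => p; exact: abse_ge0.
- move=> y _; apply: le_abse_integral => //.
  exact: (measurableT_comp mh (pair2_measurable y)).
Qed.

Lemma Rintegral2_integrable :
  m2.-integrable setT (fun y => (\int[m1]_x h (x, y))%:E).
Proof. exact: (fine_integrable fubini_G_integrable).1. Qed.

Lemma Rintegral_fubini1 :
  \int[m1]_x \int[m2]_y h (x, y) = \int[(m1 \x m2)%E]_p h p.
Proof.
congr fine; rewrite (fine_integrable (integrable_fubini_F ih)).2.
exact: integral12_prod_meas1.
Qed.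

Lemma Rintegral_fubini2 :
  \int[m2]_y \int[m1]_x h (x, y) = \int[(m1 \x m2)%E]_p h p.
Proof.
congr fine; rewrite (fine_integrable fubini_G_integrable).2.
exact: integral21_prod_meas1.
Qed.

End Rfubini.

Section Cfubini.
Context d1 d2 (T1 : measurableType d1) (T2 : measurableType d2) (R : realType).
Variables (m1 : {sigma_finite_measure set T1 -> \bar R})
  (m2 : {sigma_finite_measure set T2 -> \bar R}).
Variable h : T1 * T2 -> R[i].

Lemma cmeasurable_Cintegral1 : cmeasurable h ->
  cmeasurable (fun x => Cintegral m2 (fun y => h (x, y))).
Proof.
move=> [hR hI]; split.
  exact: (measurable_Rintegral1 m2 hR).
exact: (measurable_Rintegral1 m2 hI).
Qed.

Hypothesis ih : L1 (m1 \x m2)%E h.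

Lemma L1_sections1 : {ae m1, forall x, L1 m2 (fun y => h (x, y))}.
Proof.
have [iR iI] := (L1E _ _).1 ih.
apply: filterS2 (ae_integrable1 iR) (ae_integrable1 iI) => x xR xI.
by apply/L1E.
Qed.

Lemma L1_sections2 : {ae m2, forall y, L1 m1 (fun x => h (x, y))}.
Proof.
have [iR iI] := (L1E _ _).1 ih.
apply: filterS2 (ae_integrable2 iR) (ae_integrable2 iI) => x xR xI.
by apply/L1E.
Qed.

Lemma L1_Cintegral1 : L1 m1 (fun x => Cintegral m2 (fun y => h (x, y))).
Proof.
have [iR iI] := (L1E _ _).1 ih.
apply/L1E; split.
  exact: Rintegral1_integrable iR.
exact: Rintegral1_integrable iI.
Qed.

Lemma L1_Cintegral2 : L1 m2 (fun y => Cintegral m1 (fun x => h (x, y))).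
Proof.
have [iR iI] := (L1E _ _).1 ih.
apply/L1E; split.
  exact: Rintegral2_integrable iR.
exact: Rintegral2_integrable iI.
Qed.

Lemma Cintegral_fubini1 :
  Cintegral m1 (fun x => Cintegral m2 (fun y => h (x, y))) =
  Cintegral (m1 \x m2)%E h.
Proof.
have [iR iI] := (L1E _ _).1 ih.
by congr (_ +i* _)%C; [exact: Rintegral_fubini1 iR|exact: Rintegral_fubini1 iI].
Qed.

Lemma Cintegral_fubini2 :
  Cintegral m2 (fun y => Cintegral m1 (fun x => h (x, y))) =
  Cintegral (m1 \x m2)%E h.
Proof.
have [iR iI] := (L1E _ _).1 ih.
by congr (_ +i* _)%C; [exact: Rintegral_fubini2 iR|exact: Rintegral_fubini2 iI].
Qed.

End Cfubini.

(** By Tonelli's theorem, integrating over the first variable first, the norm is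
    the product of the norms of [f] and [g]. For a convolution, [tr p q] is
    p q^-1, or p - q in an additive group. *)
Lemma L1_translate_tensor d1 d2 (T1 : measurableType d1)
    (T2 : measurableType d2) (R : realType)
    (m1 : {sigma_finite_measure set T1 -> \bar R})
    (m2 : {sigma_finite_measure set T2 -> \bar R})
    (tr : T1 -> T2 -> T1) (f : T1 -> R[i]) (g : T2 -> R[i]) :
  measurable_fun setT (fun p : T1 * T2 => tr p.1 p.2) ->
  (forall q, measure_preserving m1 (tr ^~ q)) -> L1 m1 f -> L1 m2 g ->
  L1 (m1 \x m2)%E (fun p => f (tr p.1 p.2) * g p.2).
Proof.
move=> mtr ptr fL1 gL1.
have mf := L1_cmeasurable fL1; have mg := L1_cmeasurable gL1.
have mh : cmeasurable (fun p : T1 * T2 => f (tr p.1 p.2) * g p.2).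
  by apply: cmeasurableM; [exact: cmeasurable_comp|exact: cmeasurable_comp].
case: (mh) => hR hI; split=> //.
have mnf : measurable_fun setT (fun x => (normc (f x))%:E).
  by apply/measurable_EFinP/measurable_normc.
rewrite fubini_tonelli2; first last.
- by move=> p; rewrite lee_fin normc_ge0.
- by apply/measurable_EFinP/measurable_normc.
case: fL1 gL1 => [_ _ foo] [_ _ goo].
rewrite /fubini_G /=.
under eq_integral => q _.
  under eq_integral do rewrite ComplexField.Normc.normcM EFinM.
  rewrite ge0_integralZr//=; first last.
  - by rewrite lee_fin normc_ge0.
  - by move=> x _; rewrite lee_fin normc_ge0.
  - exact: (measurableT_comp mnf (ptr q).1).
  rewrite (integral_measure_preserving (ptr q) mnf).
  over.
rewrite ge0_integralZl//.
- rewrite lte_mul_pinfty//.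
  + by apply: integral_ge0 => x _; rewrite lee_fin normc_ge0.
  + rewrite ge0_fin_numE//.
    by apply: integral_ge0 => x _; rewrite lee_fin normc_ge0.
- exact/measurable_EFinP/measurable_normc.
- by move=> x _; rewrite lee_fin normc_ge0.
- by apply: integral_ge0 => x _; rewrite lee_fin normc_ge0.
Qed.

(** * Convolution and partial Fourier transform on the group *)

Section dotr.
Context {R : realType} {r : nat}.
Implicit Types tau s t : 'rV[R]_r.

Lemma dotrD tau s t : dotr tau (s + t) = dotr tau s + dotr tau t.
Proof.
by rewrite /dotr -big_split/=; apply: eq_bigr => i _; rewrite mxE mulrDr.
Qed.

Lemma dotrZ tau c s : dotr tau (c *: s) = c * dotr tau s.
Proof.
by rewrite /dotr mulr_sumr; apply: eq_bigr => i _; rewrite mxE mulrCA.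
Qed.

Lemma dotrN tau s : dotr tau (- s) = - dotr tau s.
Proof. by rewrite -scaleN1r dotrZ mulN1r. Qed.

End dotr.

Section nilpotent_convolution.
Context {R : realType} {m r : nat}.
Variable B : {bilinear 'rV[R]_m -> 'rV[R]_m -> 'rV[R]_r}.
Local Notation N := ('rV[R]_m * 'rV[R]_r)%type.

Lemma measurable_nil_div :
  measurable_fun setT (fun p : N * N => nil_mul B p.1 (nil_inv p.2)).
Proof.
have m11 : measurable_fun setT (fun p : N * N => p.1.1).
  exact: (measurableT_comp measurable_fst).
have m12 : measurable_fun setT (fun p : N * N => p.1.2).
  exact: (measurableT_comp measurable_snd).
have m21 : measurable_fun setT (fun p : N * N => p.2.1).
  exact: (measurableT_comp measurable_fst).
have m22 : measurable_fun setT (fun p : N * N => p.2.2).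
  exact: (measurableT_comp measurable_snd).
apply: measurable_fun_pair => /=.
  by apply: measurable_rVD => //; exact: measurable_rVN.
apply: measurable_rVD.
  by apply: measurable_rVD => //; exact: measurable_rVN.
apply: measurable_rVZ.
by apply: measurable_bilinear => //; exact: measurable_rVN.
Qed.

Lemma nil_right_translation (q : N) :
  measure_preserving nil_lebesgue (fun p : N => nil_mul B p q).
Proof.
have -> : (fun p : N => nil_mul B p q) =
    (fun p => (p.1 + q.1, p.2 + (q.2 + 2 *: B p.1 q.1))).
  by apply/funext => p; rewrite /nil_mul addrA.
have [|mtr pres] := @measure_preserving_skew_product _ _ _ _ _ _ _ _
  (fun (x : 'rV[R]_m) (s : 'rV[R]_r) => s + (q.2 + 2 *: B x q.1))
  (lebesgue_rV_translation q.1)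
  (fun x => lebesgue_rV_translation _).
  apply: measurable_fun_pair; first exact: measurable_rVD.
  apply: measurable_rVD => //; apply: measurable_rVD => //.
  by apply: measurable_rVZ; exact: measurable_bilinear.
by split=> // A mA; exact: pres.
Qed.

(** By Tonelli's theorem, the L^1 norm of the section over y is a function
    of y with finite integral, hence finite for almost every y. *)
Lemma L1_nil_sections d (T : measurableType d)
    (mu : {sigma_finite_measure set T -> \bar R}) (H : N * T -> R[i]) :
  L1 (nil_lebesgue \x mu)%E H ->
  {ae lebesgue_rV m, forall y,
    L1 (lebesgue_rV r \x mu)%E (fun p => H ((y, p.1), p.2))}.
Proof.
move=> HL1; have mH := L1_cmeasurable HL1; case: HL1 => _ _ Hoo.
have massoc y : measurable_fun setT
    (fun p : 'rV[R]_r * T => ((y, p.1), p.2) : N * T).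
  apply: measurable_fun_pair => //.
  by apply: (measurableT_comp (pair1_measurable y)).
have mnH : measurable_fun setT (fun p => (normc (H p))%:E).
  by apply/measurable_EFinP/measurable_normc.
have nH0 p : (0 <= (normc (H p))%:E)%E by rewrite lee_fin normc_ge0.
pose K p := (\int[mu]_z (normc (H (p, z)))%:E)%E.
have K0 p : (0 <= K p)%E by apply: integral_ge0.
have mK : measurable_fun setT (K : N -> \bar R).
  exact: (measurable_fun_fubini_tonelli_F _ mnH).
pose J y := (\int[lebesgue_rV r]_s K (y, s))%E.
have J0 y : (0 <= J y)%E by apply: integral_ge0.
have mJ : measurable_fun setT J.
  exact: (measurable_fun_fubini_tonelli_F _ mK).
have iJ : (lebesgue_rV m).-integrable setT J.
  apply/integrableP; split=> //; under eq_integral do rewrite gee0_abs//.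
  rewrite (fubini_tonelli1 _ mnH nH0) in Hoo.
  have <- : (\int[lebesgue_rV m \x lebesgue_rV r]_p K p =
      \int[lebesgue_rV m]_y J y)%E by exact: fubini_tonelli1.
  exact: Hoo.
apply: filterS (integrable_ae measurableT iJ) => y /(_ I) Jy.
have [mR mI] := cmeasurable_comp mH (massoc y); split=> //.
rewrite fubini_tonelli1 => [||p]; last by rewrite lee_fin normc_ge0.
  by rewrite ge0_fin_numE in Jy.
exact: (measurableT_comp mnH (massoc y)).
Qed.

Lemma L1_nil_conv_kernel (phi psi : N -> R[i]) :
  L1 nil_lebesgue phi -> L1 nil_lebesgue psi ->
  L1 (nil_lebesgue \x nil_lebesgue)%E
    (fun pq : N * N => phi (nil_mul B pq.1 (nil_inv pq.2)) * psi pq.2).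
Proof.
move=> phi1 psi1.
apply: (@L1_translate_tensor _ _ _ _ _ nil_lebesgue nil_lebesgue
  (fun p q => nil_mul B p (nil_inv q))) => //; first exact: measurable_nil_div.
by move=> q; exact: nil_right_translation.
Qed.

Lemma L1_nil_conv (phi psi : N -> R[i]) :
  L1 nil_lebesgue phi -> L1 nil_lebesgue psi ->
  L1 nil_lebesgue (nil_conv B phi psi).
Proof.
move=> phi1 psi1.
exact: (L1_Cintegral1 (L1_nil_conv_kernel phi1 psi1)).
Qed.

Variable tau : 'rV[R]_r.

Lemma cmeasurable_expi_dotr d (T : measurableType d) (f : T -> 'rV[R]_r) :
  measurable_fun setT f -> cmeasurable (fun x => expi (- dotr tau (f x))).
Proof.
move=> mf; apply: cmeasurable_expi.
by apply: measurableT_comp => //; exact: measurable_dotr.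
Qed.

Lemma cmeasurable_expi_Btau d (T : measurableType d) (f g : T -> 'rV[R]_m) :
  measurable_fun setT f -> measurable_fun setT g ->
  cmeasurable (fun x => expi (- (2 * Btau B tau (f x) (g x)))).
Proof.
move=> mf mg; apply: cmeasurable_expi.
apply: measurableT_comp => //; apply: measurable_funM => //.
by apply: measurable_dotr; exact: measurable_bilinear.
Qed.

Lemma cmeasurable_modulate (f : N -> R[i]) : cmeasurable f ->
  cmeasurable (fun p : N => expi (- dotr tau p.2) * f p).
Proof.
by move=> mf; apply: cmeasurableM => //; exact: cmeasurable_expi_dotr.
Qed.

Lemma L1_modulate (f : N -> R[i]) : L1 nil_lebesgue f ->
  L1 nil_lebesgue (fun p : N => expi (- dotr tau p.2) * f p).
Proof.
apply: L1_unimodular => [|p]; last exact: normc_expi.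
exact: cmeasurable_expi_dotr.
Qed.

Lemma L1_partial_fourier (f : N -> R[i]) :
  L1 nil_lebesgue f -> L1 (lebesgue_rV m) (partial_fourier tau f).
Proof. by move=> /L1_modulate; exact: L1_Cintegral1. Qed.

Lemma cmeasurable_partial_fourier (f : N -> R[i]) :
  cmeasurable f -> cmeasurable (partial_fourier tau f).
Proof. by move=> /cmeasurable_modulate; exact: cmeasurable_Cintegral1. Qed.

Lemma cmeasurable_twisted_conv (f g : 'rV[R]_m -> R[i]) :
  cmeasurable f -> cmeasurable g -> cmeasurable (twisted_conv B tau f g).
Proof.
move=> mf mg.
apply: (@cmeasurable_Cintegral1 _ _ _ _ _ _ (fun p : 'rV[R]_m * 'rV[R]_m =>
  expi (- (2 * Btau B tau p.1 p.2)) * f (p.1 - p.2) * g p.2)).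
apply: cmeasurableM; last exact: cmeasurable_comp.
apply: cmeasurableM; first exact: cmeasurable_expi_Btau.
apply: cmeasurable_comp => //.
by apply: measurable_rVD => //; exact: measurable_rVN.
Qed.

(** The identity at a point y over which the convolution kernel is integrable.
    Then [F], the kernel with the Fourier factor, is integrable in (s, q), and
    Fubini's theorem allows s to be integrated first. By translation invariance
    the result is [G q] for almost every q; integrating [G] over q = (x, t), t
    first, gives the twisted convolution. *)
Lemma partial_fourier_nil_conv (phi psi : N -> R[i]) (y : 'rV[R]_m) :
  cmeasurable phi -> cmeasurable psi ->
  L1 (lebesgue_rV r \x nil_lebesgue)%E
    (fun p : 'rV[R]_r * N =>
       phi (nil_mul B (y, p.1) (nil_inv p.2)) * psi p.2) ->
  twisted_conv B tau (partial_fourier tau phi) (partial_fourier tau psi) y =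
  partial_fourier tau (nil_conv B phi psi) y.
Proof.
move=> mphi mpsi HL1.
pose F (p : 'rV[R]_r * N) := expi (- dotr tau p.1) *
  (phi (nil_mul B (y, p.1) (nil_inv p.2)) * psi p.2).
have FL1 : L1 (lebesgue_rV r \x nil_lebesgue)%E F.
  apply: L1_unimodular HL1 => [|p]; last exact: normc_expi.
  exact: cmeasurable_expi_dotr.
pose c x := expi (- (2 * Btau B tau y x)) * partial_fourier tau phi (y - x).
pose G (q : N) := c q.1 * (expi (- dotr tau q.2) * psi q).
have mc : cmeasurable c.
  apply: cmeasurableM; first exact: cmeasurable_expi_Btau.
  apply: cmeasurable_comp; first exact: cmeasurable_partial_fourier.
  by apply: measurable_rVD => //; exact: measurable_rVN.
have mG : cmeasurable G.
  apply: cmeasurableM; last exact: cmeasurable_modulate.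
  exact: cmeasurable_comp.
have FG : eqL1 nil_lebesgue
    (fun q => Cintegral (lebesgue_rV r) (fun s => F (s, q))) G.
  apply: eqL1_ae => //; first exact: L1_Cintegral2.
  apply: filterS (L1_sections2 FL1) => -[x t] Fq _.
  (* (y, s)(x, t)^-1 = (y - x, s + k). *)
  pose k : 'rV[R]_r := - t + 2 *: B y (- x).
  have FE s : F (s, (x, t)) = expi (- (2 * Btau B tau y x)) *
      (expi (- dotr tau t) * psi (x, t)) *
      (expi (- dotr tau (s + k)) * phi (y - x, s + k)).
    rewrite /F /nil_mul /nil_inv /= -addrA -/k.
    have -> : expi (- dotr tau s) = expi (- (2 * Btau B tau y x)) *
        expi (- dotr tau t) * expi (- dotr tau (s + k)).
      rewrite -!expiD; congr expi.
      rewrite /k !dotrD linearNr scalerN !dotrN dotrZ -/(Btau B tau y x).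
      ring.
    ring.
  have mh : cmeasurable (fun u : 'rV[R]_r =>
      expi (- dotr tau u) * phi (y - x, u)).
    exact: (cmeasurable_comp (cmeasurable_modulate mphi)
             (pair1_measurable (y - x))).
  move: Fq; under eq_fun do rewrite FE; move=> Fq.
  rewrite (CintegralZl Fq).
  rewrite (Cintegral_measure_preserving (lebesgue_rV_translation k) mh).
  rewrite /G /c /= -/(partial_fourier tau phi (y - x)).
  by rewrite mulrAC.
have [FL1' GL1 FGae] := FG.
transitivity (Cintegral nil_lebesgue G).
  rewrite -[RHS](Cintegral_fubini1 GL1).
  apply: ae_eq_Cintegral.
  - apply: cmeasurableM => //; exact: cmeasurable_partial_fourier.
  - exact: cmeasurable_Cintegral1.
  apply: filterS (L1_sections1 GL1) => x Gx _.
  by rewrite /G /= in Gx *; rewrite (CintegralZl Gx).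
rewrite -(ae_eq_Cintegral (L1_cmeasurable FL1') mG FGae).
rewrite (Cintegral_fubini2 FL1) -(Cintegral_fubini1 FL1).
apply: ae_eq_Cintegral.
- by apply: cmeasurable_Cintegral1; exact: L1_cmeasurable FL1.
- apply: cmeasurableM; first exact: cmeasurable_expi_dotr.
  by apply: (cmeasurable_Cintegral1 _ (L1_cmeasurable HL1)).
apply: filterS (L1_sections1 FL1) => s Fs _.
by rewrite /F /= in Fs *; rewrite (CintegralZl Fs).
Qed.

End nilpotent_convolution.

Theorem proposition1p1 (R : realType) (n r : nat)
  (B : {bilinear 'rV[R]_(2 * n) -> 'rV[R]_(2 * n) -> 'rV[R]_r})
  (n_gt0 : (0 < n)%N) (r_gt0 : (0 < r)%N)
  (skewB : forall x y, B x y = - B y x)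
  (phi psi : 'rV[R]_(2 * n) * 'rV[R]_r -> R[i])
  (phi_L1 : L1 nil_lebesgue phi) (psi_L1 : L1 nil_lebesgue psi)
  (tau : 'rV[R]_r) :
  eqL1 (lebesgue_rV (2 * n))
    (twisted_conv B tau (partial_fourier tau phi) (partial_fourier tau psi))
    (partial_fourier tau (nil_conv B phi psi)).
Proof.
have mphi := L1_cmeasurable phi_L1; have mpsi := L1_cmeasurable psi_L1.
have convL1 := L1_partial_fourier tau (L1_nil_conv B phi_L1 psi_L1).
have [|_ twL1 ae_eq] := eqL1_ae convL1 (cmeasurable_twisted_conv B tau
  (cmeasurable_partial_fourier tau mphi)
  (cmeasurable_partial_fourier tau mpsi)).
  have kernelL1 := L1_nil_conv_kernel B phi_L1 psi_L1.
  apply: filterS (L1_nil_sections kernelL1) => y Hy _.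
  by rewrite -partial_fourier_nil_conv.
split=> //; exact: ae_eq_sym.
Qed.
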